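(* Let $X$ be a proper Gromov-hyperbolic space with compact boundary, and let $(\Gamma_n)_{n\in\mathbb N}$ be a sequence of semigroups of isometries of $X$ that converges geometrically to a semigroup $\Gamma$ of isometries of $X$ whose limit set contains at least two points. Then $$h_\Gamma\le\liminf_{n\to\infty}h_{\Gamma_n}.$$ In other words, the entropy is lower semicontinuous at the semigroups whose limit set contains at least two points.
   Context: Let $X$ be a metric space with base point $o$. The Gromov product is $(x|y)=\frac12(d(x,o)+d(y,o)-d(x,y))$. $X$ is $\delta$-hyperbolic if $(x|z)\ge\min\{(x|y),(y|z)\}-\delta$ for all $x,y,z\in X$, and Gromov-hyperbolic if it is $\delta$-hyperbolic for some $\delta\ge0$ ($X$ is not assumed geodesic). $X$ is proper if its closed balls are compact. A semigroup of isometries is a subset of $\mathrm{Isom}(X)$ closed under composition. Boundary: a sequence $(x_i)$ in $X$ is convergent if $\lim_{i,j\to\infty}(x_i|x_j)=\infty$. For $A\subseteq X$, $\partial A$ is the set of convergent sequences of $A$ modulo $(x_i)\sim(y_j)$ iff $\lim_{i,j\to\infty}(x_i|y_j)=\infty$. The Gromov product extends to $\overline X=X\cup\partial X$ by $(\xi|\eta)=\sup_{x_i\to\xi,\,y_j\to\eta}\liminf_{i,j\to\infty}(x_i|y_j)$, and $\overline X$ has the topology with neighbourhood basis given by the open balls of $X$ and the sets $\{x\in\overline X:(x|\xi)>-\log r\}$, $\xi\in\partial X$. The limit set of $\Gamma$ is $\Lambda_\Gamma=\partial(\Gamma o)$. Entropy: for $P\subseteq X$, $\delta_P=\limsup_{n\to\infty}\frac1n\log\#(B(o,n)\cap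 P)$; $S\subseteq X$ is separated if there is $\epsilon>0$ with $d(x,y)>\epsilon$ for all $x\ne y$ in $S$; $h_P=\sup_S\delta_{P\cap S}$ over all separated $S\subseteq X$ ($h_\emptyset=0$), possibly infinite; and $h_\Gamma=h_{\Gamma o}$. Convergence: a sequence $(\gamma_n)$ of isometries of $X$ converges to $\gamma\in\mathrm{Isom}(X)$ if for every compact $K\subseteq X$, $\gamma_n|_K\to\gamma|_K$ and $\gamma_n^{-1}|_K\to\gamma^{-1}|_K$ uniformly. A sequence $(\Gamma_n)$ of semigroups of isometries converges geometrically to a semigroup $\Gamma$ if (i) for every $\gamma\in\Gamma$ there are $\gamma_n\in\Gamma_n$ ($n\in\mathbb N$) with $\gamma_n\to\gamma$; and (ii) for every infinite $P\subseteq\mathbb N$ and every sequence $(\gamma_n)_{n\in P}$ with $\gamma_n\in\Gamma_n$ converging to some $\gamma\in\mathrm{Isom}(X)$, one has $\gamma\in\Gamma$. *)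

(* Defs.v *)
From HB Require Import structures.
From mathcomp Require Import all_boot all_order all_algebra.
From mathcomp Require Import all_classical all_reals all_analysis.

Set Implicit Arguments.
Unset Strict Implicit.
Unset Printing Implicit Defensive.

Import Order.TTheory GRing.Theory Num.Theory.
Import numFieldNormedType.Exports.

Local Open Scope classical_set_scope.
Local Open Scope ring_scope.

Section gromov_hyperbolic.
Context {R : realType} {X : metricType R}.
Implicit Types (o x y z : X) (u v : nat -> X).

Definition gromov_product o x y : R :=
  2^-1 * (mdist x o + mdist y o - mdist x y).

Definition gromov_hyperbolic o : Prop :=
  exists2 delta : R, 0 <= delta & forall x y z,
    Num.min (gromov_product o x y) (gromov_product o y z) - delta
      <= gromov_product o x z.

(* [closed_ball] from the library is the closure of the open ball, which in a
   general metric space can be smaller than the closed ball used here. *)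
Definition proper_space : Prop :=
  forall x (r : R), compact [set y | mdist x y <= r].

(* The limit as i and j tend to infinity independently is the limit along
   [filter_prod \oo \oo]. *)
Definition seq_equiv o u v : Prop :=
  gromov_product o (u ij.1) (v ij.2) @[ij --> filter_prod \oo \oo] --> +oo.

Definition seq_convergent o u : Prop := seq_equiv o u u.

(* [seq_equiv] is an equivalence relation on convergent sequences only when X is
   hyperbolic, so the quotient is given by the set of classes, which needs no
   hyperbolicity proof. *)
Definition seq_class o u : set (nat -> X) :=
  [set v | seq_convergent o v /\ seq_equiv o u v].

(* The boundary of a subset A, as a subset of the boundary of X: a point is the
   class in X of a convergent sequence with values in A. *)
Definition boundary o (A : set X) : set (set (nat -> X)) :=
  [set seq_class o u | u in [set u | seq_convergent o u /\ forall i, A (u i)]].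

Definition bordification o : Type := (X + boundary o [set: X])%type.

HB.instance Definition _ o :=
  Choice.copy (bordification o) (X + boundary o [set: X])%type.

Definition tends_to o u (p : bordification o) : Prop :=
  match p with
  | inl x => u @ \oo --> x
  | inr xi => \val xi u
  end.

Definition ext_gromov_product o (p q : bordification o) : \bar R :=
  ereal_sup
    [set limf_einf
           (fun ij => (gromov_product o (uv.1 ij.1) (uv.2 ij.2))%:E)
           (filter_prod \oo \oo)
    | uv in [set uv : (nat -> X) * (nat -> X) |
              tends_to uv.1 p /\ tends_to uv.2 q]].

Definition basic_nbhd o (p : bordification o) (r : R) : set (bordification o) :=
  match p with
  | inl x => inl @` ball x r
  | inr _ => [set q | ((- ln r)%:E < ext_gromov_product q p)%E]
  end.

(* A set is open when it contains a basic neighborhood of each of its points.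
   When X is hyperbolic, the sets [basic_nbhd p r] with [0 < r] are then a
   neighborhood basis at [p]. *)
Definition bordification_open o (U : set (bordification o)) : Prop :=
  forall p, U p -> exists2 r : R, 0 < r & basic_nbhd p r `<=` U.

Lemma basic_nbhd_le o (p : bordification o) (r s : R) :
  0 < r -> r <= s -> basic_nbhd p r `<=` basic_nbhd p s.
Proof.
move=> r0 rs; case: p => [x|xi] q /=.
  by case=> y xy <-; exists y => //; exact: le_ball xy.
apply: le_lt_trans; rewrite lee_fin lerN2 ler_ln// posrE//.
exact: lt_le_trans rs.
Qed.

Lemma bordification_openT o : bordification_open [set: bordification o].
Proof. by move=> p _; exists 1. Qed.

Lemma bordification_openI o : setI_closed (@bordification_open o).
Proof.
move=> U V Uo Vo p [/Uo[r r0 rU] /Vo[s s0 sV]].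
have m0 : 0 < Num.min r s by rewrite lt_min r0 s0.
exists (Num.min r s) => // q pq; split.
- by apply: rU; apply: basic_nbhd_le pq => //; rewrite ge_min lexx.
- by apply: sV; apply: basic_nbhd_le pq => //; rewrite ge_min lexx orbT.
Qed.

Lemma bordification_open_bigU o (I : Type) (f : I -> set (bordification o)) :
  (forall i, bordification_open (f i)) -> bordification_open (\bigcup_i f i).
Proof.
move=> fo p [i _ /fo[r r0 rf]]; exists r => // q /rf fq; by exists i.
Qed.

HB.instance Definition _ o := isOpenTopological.Build (bordification o)
  (@bordification_openT o) (@bordification_openI o)
  (@bordification_open_bigU o).

Definition compact_boundary o : Prop :=
  compact (range (inr : boundary o [set: X] -> bordification o)).

End gromov_hyperbolic.
Arguments proper_space {R} X.

Section metric_isometries.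
Context {R : realType} {X : metricType R}.

Record metric_isometry := MetricIsometry {
  isom_fun :> X -> X ;
  isom_inv : X -> X ;
  isom_funK : cancel isom_fun isom_inv ;
  isom_invK : cancel isom_inv isom_fun ;
  isom_mdist : forall x y,
    mdist (isom_fun x) (isom_fun y) = mdist x y
}.

Lemma isom_eq (g h : metric_isometry) : (g : X -> X) = h -> g = h.
Proof.
case: g h => [f f' fK f'K fd] [g g' gK g'K gd] /= fg; subst g.
have f'g' : f' = g' by apply/funext => x; rewrite -[x in LHS]g'K fK.
subst g'; congr MetricIsometry; exact: Prop_irrelevance.
Qed.

Lemma isom_comp_mdist (g h : metric_isometry) x y :
  mdist ((g \o h) x) ((g \o h) y) = mdist x y.
Proof. by rewrite /= !isom_mdist. Qed.

Definition isom_comp (g h : metric_isometry) : metric_isometry :=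
  @MetricIsometry (g \o h) (isom_inv h \o isom_inv g)
    (can_comp (@isom_funK g) (@isom_funK h))
    (can_comp (@isom_invK h) (@isom_invK g))
    (isom_comp_mdist g h).

Definition isom_semigroup (G : set metric_isometry) : Prop :=
  forall g h, G g -> G h -> G (isom_comp g h).

Definition orbit_of (G : set metric_isometry) (o : X) : set X :=
  [set g o | g in G].

Definition limit_set (G : set metric_isometry) (o : X) : set (set (nat -> X)) :=
  boundary o (orbit_of G o).

(* Convergence along a filter on the indices: [\oo] for a sequence indexed by
   nat, [within P \oo] for a sequence indexed by an infinite [P]. *)
Definition isom_cvg (F : set_system nat) (g_ : nat -> metric_isometry)
    (g : metric_isometry) : Prop :=
  forall K : set X, compact K ->
    {uniform K, (fun n => g_ n : X -> X) @ F --> (g : X -> X)} /\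
    {uniform K, (fun n => isom_inv (g_ n)) @ F --> isom_inv g}.

(* In the second clause only the values of [g_] on [P] matter. *)
Definition geometric_cvg (G_ : nat -> set metric_isometry)
    (G : set metric_isometry) : Prop :=
  (forall g, G g -> exists g_ : nat -> metric_isometry,
     (forall n, G_ n (g_ n)) /\ isom_cvg \oo g_ g) /\
  (forall (P : set nat) (g_ : nat -> metric_isometry) (g : metric_isometry),
     infinite_set P -> (forall n, P n -> G_ n (g_ n)) ->
     isom_cvg (within P \oo) g_ g -> G g).

End metric_isometries.
Arguments metric_isometry {R} X.

Section entropy.
Context {R : realType} {X : metricType R}.
Local Open Scope ereal_scope.

(* [counting] takes the value +oo on infinite sets, and lne 0 = -oo. *)
Definition growth_exponent (o : X) (P : set X) : \bar R :=
  limn_esup (fun n => (n%:R^-1)%:E * lne (counting (ball o n%:R `&` P))).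

Definition separated_set (S : set X) : Prop :=
  exists2 e : R, (0 < e)%R &
    forall x y, S x -> S y -> x <> y -> (e < mdist x y)%R.

(* The empty set is singled out because the supremum would give it -oo. *)
Definition entropy (o : X) (P : set X) : \bar R :=
  if `[< P = set0 >] then 0
  else ereal_sup [set growth_exponent o (P `&` S) | S in separated_set].

Definition isom_entropy (o : X) (G : set (metric_isometry X)) : \bar R :=
  entropy o (orbit_of G o).

End entropy.

(* Main.v *)
Require Import Defs.
From mathcomp Require Import all_boot all_order all_algebra.
From mathcomp Require Import all_classical all_reals all_analysis.
From mathcomp Require Import lra.

(** The limit semigroup could have more entropy than its approximations only if
    infinitely many of its elements were needed at once to see this entropy.
    This is not so: up to an arbitrarily small loss, the entropy of [Gamma] is
    that of a free subsemigroup with finitely many generators in Schottky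
    position, and this position survives a perturbation.

    A finite family of isometries is in Schottky position ([schottky]) when the
    displacements are nearly equal to a large [r], the images of [o] are far
    apart, and the Gromov products of the points [isom_inv (a i) o] and [a j o]
    are bounded. The last condition makes words in the family move [o] along
    quasigeodesics, so that distinct words give separated points. [N] generators
    then give [N ^ k] separated orbit points in the ball of radius [k * (r + 1)],
    and the entropy is at least [ln N / (r + 1)] ([schottky_entropy]). As the
    condition is open, elements of [Gamma_ n] converging to the generators are in
    Schottky position for large [n] ([schottky_near]), and the same lower bound
    holds for the entropy of [Gamma_ n].

    It remains to find, for [h' < h < h_Gamma], a Schottky family with
    [h' * (r + 1) <= ln N] ([schottky_ex]). The definition of entropy gives
    about [exp (h * n)] separated orbit points [g o] at distance at most [n], for
    arbitrarily large [n]. Pigeonhole arguments make the displacements equal up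
    to [1] and the directions of the points [g o] equal up to a bounded error.
    Two facts are needed. Firstly, there must be finitely many directions at each
    scale: the boundary is compact, and orbit points do point towards boundary
    points, because an isometry that does not do so for the image of one limit
    point does so for the image of another one ([orbit_points_towards],
    [direction_coloring]). Secondly, the direction of [g o] must differ from that
    of [isom_inv g o]. This is achieved by multiplying [g] on the left by one of
    a number of isometries that is linear in [n] ([reducible_turning]). If
    [Gamma] fixes no boundary point, then by compactness finitely many elements
    of [Gamma] suffice ([reducible_turning_no_fixed_point]). If [Gamma] fixes a
    boundary point, then a second limit point provides an element that repels the
    fixed point, and [g] is multiplied by the power of it that brings [g o] away
    from the fixed point without lengthening [g]
    ([reducible_turning_fixed_point]). *)

Set Implicit Arguments.
Unset Strict Implicit.
Unset Printing Implicit Defensive.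

Import Order.TTheory GRing.Theory Num.Theory.
Import numFieldNormedType.Exports.

Local Open Scope classical_set_scope.
Local Open Scope ring_scope.

(** * Gromov products and isometries *)

Section gromov_product_lemmas.
Context {R : realType} {X : metricType R} (o : X).
Implicit Types (x y z : X) (g h : metric_isometry X) (u v w : nat -> X).

Local Notation gp := (gromov_product o).

Lemma gpC x y : gp x y = gp y x.
Proof. by rewrite /gromov_product (metric_sym x y); lra. Qed.

Lemma gp_ge0 x y : 0 <= gp x y.
Proof.
rewrite /gromov_product; have := metric_triangle x o y.
by rewrite (metric_sym o y); lra.
Qed.

Lemma gp_le_distl x y : gp x y <= mdist x o.
Proof.
rewrite /gromov_product; have := metric_triangle y x o.
by rewrite (metric_sym y x); lra.
Qed.

Lemma gp_le_distr x y : gp x y <= mdist y o.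
Proof. by rewrite gpC gp_le_distl. Qed.

Lemma gp_perturb x y x' : gp x y <= gp x' y + mdist x x'.
Proof.
rewrite /gromov_product.
have := metric_triangle x x' o; have := metric_triangle x' x y.
by rewrite (metric_sym x' x); lra.
Qed.

Lemma mdist_gp x y : mdist x y = mdist x o + mdist y o - 2 * gp x y.
Proof. by rewrite /gromov_product; lra. Qed.

Lemma isom_inv_mdist g x y : mdist (isom_inv g x) (isom_inv g y) = mdist x y.
Proof. by rewrite -(isom_mdist g) !isom_invK. Qed.

Lemma mdist_isom_swap g x y : mdist (g x) y = mdist x (isom_inv g y).
Proof. by rewrite -[in RHS](isom_mdist g) isom_invK. Qed.

Definition displacement g : R := mdist (g o) o.

Local Notation len := displacement.

Lemma displacement_ge0 g : 0 <= len g. Proof. exact: mdist_ge0. Qed.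

Lemma displacement_inv g : mdist (isom_inv g o) o = len g.
Proof. by rewrite /displacement mdist_isom_swap metric_sym. Qed.

(** Moving both points by an isometry amounts to changing the base point, and
    the change of base point is exact, with no hyperbolicity error. *)
Lemma gp_isom g x y :
  gp (g x) (g y) = gp x y + len g - gp x (isom_inv g o) - gp y (isom_inv g o).
Proof.
rewrite /gromov_product isom_mdist !mdist_isom_swap displacement_inv.
rewrite /displacement mdist_isom_swap; have := displacement_inv g.
rewrite /displacement mdist_isom_swap metric_sym.
set a := mdist _ _; set b := mdist _ _; set c := mdist x o.
by lra.
Qed.

Lemma gp_isom_origin g x : gp (g o) (g x) = len g - gp x (isom_inv g o).
Proof.
rewrite gp_isom /gromov_product (metric_sym o (isom_inv g o)) !mdistxx.
rewrite (metric_sym o x).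
by lra.
Qed.

Lemma gp_isom_ge g x y : gp x y - len g <= gp (g x) (g y).
Proof.
rewrite gp_isom; have := gp_ge0 x y.
have := gp_le_distr x (isom_inv g o); have := gp_le_distr y (isom_inv g o).
by rewrite !displacement_inv; lra.
Qed.

Lemma displacement_comp g h :
  len (isom_comp g h) = len g + len h - 2 * gp (h o) (isom_inv g o).
Proof.
rewrite /displacement /= mdist_isom_swap mdist_gp displacement_inv /displacement.
by lra.
Qed.

End gromov_product_lemmas.

(** * Boundary points and compactness of the boundary *)

(** Near coverings along the filter of the finite sequences that are large for
    inclusion give finite covers, by neighborhoods that need not be open. *)
Lemma compact_finite_cover (T : topologicalType) (A : set T) (U : T -> set T) :
  compact A -> (forall x, A x -> nbhs x (U x)) ->
  exists s : seq T, forall y, A y -> exists x, [/\ x \in s, A x & U x y].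
Proof.
move=> /compact_near_coveringP cA nU.
pose F : set_system (seq T) :=
  filter_from [set: seq T] (fun s => [set s' | {subset s <= s'}]).
have FF : Filter F.
  apply: filter_from_filter; first by exists [::].
  move=> s t _ _; exists (s ++ t) => // s' st.
  by split=> x xs; apply: st; rewrite mem_cat xs ?orbT.
have [|s _ sP] := cA _ F (fun s y => exists x, [/\ x \in s, A x & U x y]) FF;
  last by exists s => y Ay; apply: (sP s).
move=> x Ax; exists (U x, [set s | x \in s]) => /=.
  split; first exact: nU.
  by exists [:: x] => // s; apply; rewrite mem_head.
by move=> [y s] /= [Uy xs]; exists x.
Qed.

Section limf_einf_lemmas.
Local Open Scope ereal_scope.

Lemma lt_limf_einf (R : realType) (T : choiceType) (Y : filteredType T)
    (f : Y -> \bar R) (F : set_system Y) (t : \bar R) :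
  t < limf_einf f F -> exists2 A, F A & forall x, A x -> t < f x.
Proof.
rewrite /limf_einf /limf_esup lteNr => /ereal_inf_lt[_ [A FA <-]] lt.
exists A => // x Ax; rewrite -lteN2; apply: le_lt_trans lt.
by apply: ereal_sup_ubound; exists x.
Qed.

Lemma le_limf_einf (R : realType) (T : choiceType) (Y : filteredType T)
    (f : Y -> \bar R) (F : set_system Y) (t : \bar R) (A : set Y) :
  F A -> (forall x, A x -> t <= f x) -> t <= limf_einf f F.
Proof.
move=> FA le; rewrite /limf_einf /limf_esup leeNr.
apply: ge_ereal_inf; exists (ereal_sup [set - f x | x in A]).
  by exists A.
by apply: ge_ereal_sup => _ [x Ax <-]; rewrite leeN2 le.
Qed.

End limf_einf_lemmas.

Section eventually_close.
Context {R : realType} {X : metricType R} (o : X).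
Implicit Types (x y z : X) (g h : metric_isometry X) (u v w : nat -> X).

Local Notation gp := (gromov_product o).

(** [eventually_close t u v] says that the limits of [u] and [v] have Gromov
    product more than [t], up to an error controlled by the hyperbolicity constant. *)
Definition eventually_close (t : R) u v :=
  exists N : nat, forall i j, (N <= i)%N -> (N <= j)%N -> t < gp (u i) (v j).

Lemma near_filter_prodP (P : nat -> nat -> Prop) :
  (\forall ij \near filter_prod \oo \oo, P ij.1 ij.2) <->
  exists N : nat, forall i j, (N <= i)%N -> (N <= j)%N -> P i j.
Proof.
split=> [[[A B] /= [[N _ NA] [M _ MB]] AB]|[N NP]].
  exists (maxn N M) => i j; rewrite !geq_max => /andP[Ni _] /andP[_ Mj].
  by apply: (AB (i, j)); split; [apply: NA|apply: MB].
exists ([set i | (N <= i)%N], [set j | (N <= j)%N]) => /=.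
  by split; exists N.
by move=> [i j] /= [Ni Nj]; apply: NP.
Qed.

Lemma seq_equivP u v : seq_equiv o u v <-> forall t, eventually_close t u v.
Proof.
rewrite /seq_equiv cvgryPgt; split=> uv t.
  exact/(near_filter_prodP (fun i j => t < gp (u i) (v j))).
by apply/(near_filter_prodP (fun i j => t < gp (u i) (v j))); exact: uv.
Qed.

Lemma eventually_close_le s t u v :
  s <= t -> eventually_close t u v -> eventually_close s u v.
Proof.
by move=> st [N uv]; exists N => i j Ni Nj; apply: le_lt_trans st _; apply: uv.
Qed.

Lemma eventually_close_sym t u v :
  eventually_close t u v -> eventually_close t v u.
Proof. by move=> [N uv]; exists N => i j Ni Nj; rewrite gpC; apply: uv. Qed.

Lemma seq_equiv_sym u v : seq_equiv o u v -> seq_equiv o v u.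
Proof.
by move=> /seq_equivP uv; apply/seq_equivP => t; apply: eventually_close_sym.
Qed.

Lemma eventually_close_isom g t u v :
  eventually_close t u v ->
  eventually_close (t - displacement o g) (g \o u) (g \o v).
Proof.
move=> [N uv]; exists N => i j Ni Nj.
by have := gp_isom_ge o g (u i) (v j); have := uv _ _ Ni Nj; rewrite /=; lra.
Qed.

Lemma seq_equiv_isom g u v : seq_equiv o u v -> seq_equiv o (g \o u) (g \o v).
Proof.
move=> /seq_equivP uv; apply/seq_equivP => t.
have := eventually_close_isom g (uv (t + displacement o g)).
by rewrite addrK.
Qed.

End eventually_close.

Section hyperbolic.
Context {R : realType} {X : metricType R} (o : X) (delta : R).
Implicit Types (x y z : X) (g h : metric_isometry X) (u v w : nat -> X).

Local Notation gp := (gromov_product o).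

Hypothesis delta_ge0 : 0 <= delta.
Hypothesis hypX : forall x y z, Num.min (gp x y) (gp y z) - delta <= gp x z.

Lemma gp_hyp (a : R) y x z : a <= gp x y -> a <= gp y z -> a - delta <= gp x z.
Proof.
move=> xy yz; apply: le_trans (hypX x y z).
by rewrite lerD2r le_min xy yz.
Qed.

Lemma gp_hyp_lt (a : R) y x z : a < gp x y -> a < gp y z -> a - delta < gp x z.
Proof.
move=> xy yz; apply: lt_le_trans (hypX x y z).
by rewrite ltrD2r lt_min xy yz.
Qed.

Lemma eventually_close_trans t v u w :
  eventually_close o t u v -> eventually_close o t v w ->
  eventually_close o (t - delta) u w.
Proof.
move=> [N uv] [M vw]; exists (maxn N M) => i j.
rewrite !geq_max => /andP[Ni Mi] /andP[Nj Mj].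
by apply: (@gp_hyp_lt _ (v (maxn N M))); [apply: uv|apply: vw] => //;
  rewrite ?leq_maxl ?leq_maxr.
Qed.

Lemma seq_equiv_trans v u w :
  seq_equiv o u v -> seq_equiv o v w -> seq_equiv o u w.
Proof.
move=> /seq_equivP uv /seq_equivP vw; apply/seq_equivP => t.
by rewrite -(addrK delta t); apply: eventually_close_trans (uv _) (vw _).
Qed.

Lemma tends_to_boundary u v (xi : boundary o [set: X]) :
  tends_to u (inr xi) -> tends_to v (inr xi) -> seq_equiv o u v.
Proof.
case: xi => [A AP] /=; have := set_mem AP => -[w [wc _] <-] [_ wu] [_ wv].
exact: seq_equiv_trans (seq_equiv_sym wu) wv.
Qed.

Lemma boundary_rep_ex (xi : boundary o [set: X]) :
  exists u, seq_convergent o u /\ tends_to u (inr xi).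
Proof. by case: xi => [A AP] /=; have := set_mem AP => -[w [wc _] <-]; exists w. Qed.

(** Boundary points are sets of sequences; all the estimates are made on a
    chosen representative. *)
Definition boundary_rep (xi : boundary o [set: X]) : nat -> X :=
  sval (cid (boundary_rep_ex xi)).

Lemma boundary_rep_convergent xi : seq_convergent o (boundary_rep xi).
Proof. by rewrite /boundary_rep; case: cid => u []. Qed.

Lemma boundary_rep_tends_to xi : tends_to (boundary_rep xi) (inr xi).
Proof. by rewrite /boundary_rep; case: cid => u []. Qed.

Lemma convergent_boundary_rep u : seq_convergent o u ->
  exists xi, seq_equiv o u (boundary_rep xi).
Proof.
move=> uc; have uB : seq_class o u \in boundary o [set: X].
  by apply/mem_set; exists u.
pose xi : boundary o [set: X] := SigSub uB.
exists xi; apply: (@tends_to_boundary _ _ xi); last exact: boundary_rep_tends_to.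
by split.
Qed.

(** The supremum over all representatives exceeds the value of any one of them
    by at most [2 * delta]. *)
Lemma ext_gromov_product_close (t : R) (xi eta : boundary o [set: X]) :
  (t%:E < ext_gromov_product (inr xi) (inr eta))%E ->
  eventually_close o (t - 2 * delta) (boundary_rep xi) (boundary_rep eta).
Proof.
move=> /ereal_sup_gt[_ [[u v] [/= ux ve] <-]] /lt_limf_einf[A FA At].
have {At FA A}uv : eventually_close o t u v.
  apply/(near_filter_prodP (fun i j => t < gp (u i) (v j))).
  by apply: filterS FA => ij /At.
have /seq_equivP xu := tends_to_boundary (boundary_rep_tends_to xi) ux.
have /seq_equivP ve' := tends_to_boundary ve (boundary_rep_tends_to eta).
have -> : t - 2 * delta = t - delta - delta by lra.
apply: eventually_close_trans (ve' _).
exact: eventually_close_trans (xu _) uv.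
Qed.

Lemma close_ext_gromov_product (t : R) (xi eta : boundary o [set: X]) :
  eventually_close o t (boundary_rep xi) (boundary_rep eta) ->
  (t%:E <= ext_gromov_product (inr xi) (inr eta))%E.
Proof.
move=> xe; apply: le_ereal_sup_tmp.
exists (limf_einf
  (fun ij => (gp (boundary_rep xi ij.1) (boundary_rep eta ij.2))%:E)
  (filter_prod \oo \oo)).
  exists (boundary_rep xi, boundary_rep eta) => //=.
  split; exact: boundary_rep_tends_to.
move/(near_filter_prodP (fun i j => t < gp _ _)) : xe => xe.
by apply: le_limf_einf xe _ => ij /= tij; rewrite lee_fin ltW.
Qed.

(** This is the form in which compactness of the boundary is used: at a scale
    [s] that may vary with the center, finitely many boundary points suffice.

    Neighborhoods of a boundary point may contain all of [X] without harm, since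
    only their boundary points matter for covering the boundary. The boundary
    points close to the center need not form an open set; [V] keeps those having
    a whole basic neighborhood of boundary points close to the center. *)
Lemma boundary_cover (s : (nat -> X) -> R) : compact_boundary o ->
  exists (m : nat) (U : nat -> nat -> X), forall v, seq_convergent o v ->
    exists i, [/\ (i < m)%N, seq_convergent o (U i)
                & eventually_close o (s (U i)) v (U i)].
Proof.
move=> cB.
pose rep := boundary_rep.
pose V (xi : boundary o [set: X]) : set (bordification o) := [set q |
  match q with
  | inl _ => True
  | inr eta => eventually_close o (s (rep xi) + delta) (rep eta) (rep xi) /\
     exists T : R, forall zeta : boundary o [set: X],
       (T%:E < ext_gromov_product (inr zeta) (inr eta))%E ->
       eventually_close o (s (rep xi) + delta) (rep zeta) (rep xi)
  end].
have Vopen xi : bordification_open (V xi).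
  move=> [x _|eta [_ [T Teta]]]; first by exists 1 => // _ [y _ <-].
  pose T' := T + 3 * delta + 1.
  exists (expR (- T')); first exact: expR_gt0.
  move=> [//|zeta] /=; rewrite expRK opprK => /[dup] ze.
  move=> /ext_gromov_product_close zeta_eta; split.
    apply: Teta; apply: lt_trans ze; rewrite lte_fin /T'.
    by have := delta_ge0; lra.
  exists T' => theta /ext_gromov_product_close theta_zeta.
  apply: Teta; have := eventually_close_trans theta_zeta zeta_eta.
  move=> /close_ext_gromov_product; apply: lt_le_trans.
  by rewrite lte_fin /T'; lra.
have Vcenter xi : V xi (inr xi).
  split; first by move: (s _ + _); apply/seq_equivP/boundary_rep_convergent.
  exists (s (rep xi) + 3 * delta) => zeta /ext_gromov_product_close.
  by apply: eventually_close_le; lra.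
pose U (p : bordification o) : set (bordification o) :=
  if p is inr xi then V xi else setT.
have [p [xi _ <-]|l lP] := compact_finite_cover cB (U := U).
  by apply: open_nbhs_nbhs; split; [exact: Vopen|exact: Vcenter].
exists (size l), (fun i => if nth (inl o) l i is inr xi then rep xi else fun=> o).
move=> v /convergent_boundary_rep[eta veta].
have [|p [pl [xi _ pE]]] := lP (inr eta); first by exists eta.
rewrite -{}pE in pl * => -[etaxi _].
exists (index (inr xi : bordification o) l); rewrite index_mem nth_index//.
split=> //; first exact: boundary_rep_convergent.
rewrite -(addrK delta (s _)).
by apply: eventually_close_trans etaxi; move/seq_equivP : veta; apply.
Qed.

End hyperbolic.

(** * Directions of isometries *)

Lemma finite_upper_bound (R : realDomainType) (m : nat) (F : nat -> R) :
  exists2 B, 0 <= B & forall i, (i < m)%N -> F i <= B.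
Proof.
exists (\sum_(i < m) `|F i|) => [|i im]; first exact: sumr_ge0.
by rewrite (bigD1 (Ordinal im))//= (le_trans (ler_norm _))// lerDl sumr_ge0.
Qed.

Section isom_id.
Context {R : realType} {X : metricType R}.

Definition isom_id : metric_isometry X :=
  @MetricIsometry R X id id (fun=> erefl) (fun=> erefl) (fun _ _ => erefl).

Lemma isom_comp1 g : isom_comp isom_id g = g.
Proof. exact: isom_eq. Qed.

End isom_id.

Section directions.
Context {R : realType} {X : metricType R} (o : X) (delta : R).
Implicit Types (x y z : X) (g h : metric_isometry X) (u v w : nat -> X).

Local Notation gp := (gromov_product o).
Local Notation len := (displacement o).

Hypothesis delta_ge0 : 0 <= delta.
Hypothesis hypX : forall x y z, Num.min (gp x y) (gp y z) - delta <= gp x z.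

Let hyp_lt := gp_hyp_lt hypX.
Let hyp_le := gp_hyp hypX.

(** Since [gp (g o) x <= len g] for every [x], this says that a ray from [o] to
    the limit of [theta] passes within a distance about [C] of [g o]. *)
Definition points_towards (C : R) (theta : nat -> X) g :=
  seq_convergent o theta /\
  exists N : nat, forall i, (N <= i)%N -> len g - C <= gp (g o) (theta i).

(** Without geodesics, and without compactness of the whole bordification, it is
    not clear that far orbit points have boundary points in their direction.
    They do as soon as two distinct boundary points are available: if [g \o u]
    does not lie in the direction of [g o], then the inverse of [g] sends [o]
    close to the limit of [u], and this cannot happen for both [u] and [v]. *)
Lemma orbit_points_towards u v :
  seq_convergent o u -> seq_convergent o v -> ~ seq_equiv o u v ->
  exists2 C, 0 <= C & forall g, exists theta, points_towards C theta g.
Proof.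
move=> uc vc uv.
have [c c0 cuv] : exists2 c, 0 <= c & ~ eventually_close o c u v.
  apply: contrapT => nuv; apply: uv; apply/seq_equivP => t.
  apply: contrapT => tuv; apply: nuv; exists (Num.max t 0).
    by rewrite le_max lexx orbT.
  by apply: contra_not tuv; apply: eventually_close_le; rewrite le_max lexx.
exists (c + 2 * delta) => [|g]; first by have := delta_ge0; lra.
set C := c + _; pose p := isom_inv g o.
have frequently w : seq_convergent o w -> ~ points_towards C (g \o w) g ->
    exists N : nat, forall i, (N <= i)%N -> C - delta < gp p (w i).
  move=> wc ng; have /seq_equivP/(_ C)[N wN] := wc.
  exists N => i Ni; apply: contrapT => pi; apply: ng; split.
    exact: seq_equiv_isom.
  exists N => j Nj; rewrite gp_isom_origin lerB// leNgt; apply/negP => Cj.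
  apply: pi; apply: hyp_lt (wN _ _ Nj Ni).
  by rewrite gpC.
have [|gu] := pselect (points_towards C (g \o u) g); first by exists (g \o u).
have [|gv] := pselect (points_towards C (g \o v) g); first by exists (g \o v).
have [N Nu] := frequently _ uc gu; have [M Mv] := frequently _ vc gv.
case: cuv; exists (maxn N M) => i j.
rewrite !geq_max => /andP[Ni _] /andP[_ Mj].
have -> : c = C - delta - delta by rewrite /C; lra.
by apply: hyp_lt (Mv _ Mj); rewrite gpC; apply: Nu.
Qed.

(** Two isometries have the same color when they point towards boundary points
    close to the same point of a finite net of the boundary. *)
Lemma direction_coloring (C : R) :
  0 <= C -> (forall g, exists theta, points_towards C theta g) ->
  compact_boundary o ->
  exists2 A, 0 <= A & forall t : R, exists (m : nat) (color : metric_isometry X -> nat),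
    (forall g, (color g < m)%N) /\
    forall g h a, color g = color h -> a <= len g -> a <= len h -> a <= t ->
      a - A <= gp (g o) (h o).
Proof.
move=> C0 dir cB; exists (C + 3 * delta) => [|t].
  by have := delta_ge0; lra.
have [m [U mU]] := boundary_cover delta_ge0 hypX (fun=> t) cB.
have /choice[color colorP] g : exists i : nat, (i < m)%N /\ exists theta,
    points_towards C theta g /\ eventually_close o t theta (U i).
  have [theta gtheta] := dir g; have [i [im _ ti]] := mU _ gtheta.1.
  by exists i; split => //; exists theta.
exists m, color; split=> [g|g h a gh ag ah at_].
  by have [] := colorP g.
have [_ [theta [[_ [N1 gtheta]] [N2 thetaU]]]] := colorP g.
have [_ [theta' [[_ [N3 htheta]] [N4 thetaU']]]] := colorP h.
rewrite -gh in thetaU'.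
pose N := maxn (maxn N1 N2) (maxn N3 N4).
have N1N : (N1 <= N)%N by rewrite /N !leq_max leqnn.
have N2N : (N2 <= N)%N by rewrite /N !leq_max leqnn !orbT.
have N3N : (N3 <= N)%N by rewrite /N !leq_max leqnn !orbT.
have N4N : (N4 <= N)%N by rewrite /N !leq_max leqnn !orbT.
have e1 : a - C <= gp (g o) (theta N) by have := gtheta _ N1N; lra.
have e2 : a - C <= gp (theta N) (U (color g) N).
  by have := thetaU _ _ N2N N2N; lra.
have e3 : a - C <= gp (U (color g) N) (theta' N).
  by rewrite gpC; have := thetaU' _ _ N4N N4N; lra.
have e4 : a - C <= gp (theta' N) (h o).
  by rewrite gpC; have := htheta _ N3N; lra.
have e12 := hyp_le e1 e2.
have e34 := hyp_le e3 e4.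
by have := hyp_le e12 e34; have := delta_ge0; lra.
Qed.

(** Geodesically, a concatenation of segments from [o] to [a o], from [a o] to
    [a b o], and so on is a quasigeodesic when [a o] and the image of [o] under
    the inverse of [a] are far apart as seen from [o], and likewise for [b], with
    all directions alike. The elements of [G] need not have this property, but
    each of them acquires it after left multiplication by one of the [Phi s],
    without becoming longer. Few [s] are needed, namely a number linear in the
    length, so that this modification does not affect exponential growth; and
    left multiplication by a common isometry preserves separation of orbits. *)
Definition reducible_turning (G : set (metric_isometry X)) :=
  exists (c : R) (Phi : nat -> metric_isometry X), 0 <= c /\
    forall g, G g -> exists s : nat, let a := isom_comp (Phi s) g in
      [/\ s%:R <= len g + c, G a, len a <= len g + c
        & gp (a o) (isom_inv a o) <= c].

(** By compactness, finitely many elements of [G] suffice to move every boundary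
    point by a definite amount. If [g] turns back, multiply it by the one that
    moves the direction of [g o]: this changes the direction in which [g] arrives
    without changing much the direction from which it comes. *)
Lemma reducible_turning_no_fixed_point (G : set (metric_isometry X)) (C : R) :
  0 <= C -> (forall g, exists theta, points_towards C theta g) ->
  compact_boundary o -> isom_semigroup G ->
  (forall w, seq_convergent o w -> exists2 f, G f & ~ seq_equiv o (f \o w) w) ->
  reducible_turning G.
Proof.
move=> C0 dir cB Gs nfix.
have /choice[fc fcP] w : exists fc : metric_isometry X * R, seq_convergent o w ->
    G fc.1 /\ ~ eventually_close o fc.2 (fc.1 \o w) w.
  have [wc|//] := pselect (seq_convergent o w); last by exists (isom_id, 0).
  have [f Gf nw] := nfix _ wc.
  have [t tw] : exists t, ~ eventually_close o t (f \o w) w.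
    by apply/existsNP => fw; apply/nw/seq_equivP.
  by exists (f, t).
(* If f moves w by a definite amount, then it also moves every boundary point
   closer to w than s w. *)
pose s w := (fc w).2 + 2 * delta + len (fc w).1.
have [m [U mU]] := boundary_cover delta_ge0 hypX s cB.
pose f i := (fc (U i)).1.
have [B B0 fB] := finite_upper_bound m (fun i => len (f i)).
have [B' B'0 cB'] := finite_upper_bound m (fun i => (fc (U i)).2 + 2 * delta).
pose T := C + B + B' + 3 * delta + 1.
exists (T + B + m%:R), (fun i => if (i < m)%N then f i else isom_id).
have d0 := delta_ge0; have m0 : 0 <= m%:R :> R by [].
have T0 : 0 <= T by rewrite /T; lra.
split; first by lra.
move=> g Gg; have g0 := displacement_ge0 o g.
have [gT|gT] := leP (gp (g o) (isom_inv g o)) T.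
  (* Index m stands for the identity. *)
  by exists m; rewrite ltnn isom_comp1; split=> //; lra.
have [theta [thetac [N gtheta]]] := dir g.
have [i [im Uc tU]] := mU _ thetac.
have [Gf nf] := fcP _ Uc.
have {}fB := fB _ im; have {}cB' := cB' _ im.
have im' : i%:R <= m%:R :> R by rewrite ler_nat ltnW.
exists i; rewrite im; split; [lra|exact: Gs| |].
  by rewrite displacement_comp; have := gp_ge0 o (g o) (isom_inv (f i) o); lra.
have /= : gp (f i (g o)) (isom_inv g o) <= T.
  rewrite leNgt; apply/negP => fgT; apply: nf.
  have fg : T - delta < gp (g o) (f i (g o)).
    by apply: hyp_lt gT _; rewrite gpC.
  have gl := gp_le_distl o (g o) (isom_inv g o); rewrite -/(len g) in gl.
  have ftheta : eventually_close o (s (U i) - len (f i)) (f i \o theta) theta.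
    exists N => k l Nk Nl /=.
    have e1 : T - C - B - delta <= gp (f i (theta k)) (f i (g o)).
      have := gp_isom_ge o (f i) (theta k) (g o).
      by rewrite (gpC _ _ (g o)); have := gtheta _ Nk; lra.
    have e2 : T - C - B - delta <= gp (f i (g o)) (g o) by rewrite gpC; lra.
    have e3 : T - C - B - delta - delta <= gp (g o) (theta l).
      by have := gtheta _ Nl; lra.
    have := hyp_le (hyp_le e1 e2) e3.
    by rewrite /s -/(f i) /T; rewrite /T in gT; lra.
  have := eventually_close_isom (f i) (eventually_close_sym tU).
  move=> /(eventually_close_trans hypX)/(_ ftheta).
  have : s (U i) - len (f i) - delta <= s (U i).
    by have := displacement_ge0 o (f i); lra.
  move=> /eventually_close_le/(_ tU) + U1.
  move=> /(eventually_close_trans hypX U1).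
  by apply: eventually_close_le; rewrite /s -/(f i); lra.
have := gp_perturb o (isom_inv g (isom_inv (f i) o)) (f i (g o)) (isom_inv g o).
rewrite isom_inv_mdist displacement_inv (gpC _ (isom_inv g _)).
by rewrite (gpC _ (isom_inv g o)) /=; lra.
Qed.

End directions.

(** * Semigroups fixing a boundary point *)

Section fixed_point.
Context {R : realType} {X : metricType R} (o : X) (delta : R).
Implicit Types (x y : X) (f g h : metric_isometry X) (u v w z : nat -> X).

Local Notation gp := (gromov_product o).
Local Notation len := (displacement o).

Hypothesis delta_ge0 : 0 <= delta.
Hypothesis hypX : forall x y y', Num.min (gp x y) (gp y y') - delta <= gp x y'.

Let hyp_lt := gp_hyp_lt hypX.
Let hyp_le := gp_hyp hypX.

(** [p x] is the Gromov product of [x] with the limit of [z], up to [delta];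
    no limit along [z] has to be chosen. *)
Definition boundary_gp_approx z (p : X -> R) :=
  forall x, exists N : nat, forall j, (N <= j)%N ->
    p x - delta <= gp x (z j) /\ gp x (z j) <= p x + delta.

Lemma boundary_gp_approx_ex z : seq_convergent o z ->
  exists p, boundary_gp_approx z p.
Proof.
move=> /seq_equivP zc.
suff /choice[p pz] x : exists a : R, exists N : nat, forall j, (N <= j)%N ->
    a - delta <= gp x (z j) /\ gp x (z j) <= a + delta by exists p.
have [N zN] := zc (mdist x o); exists (gp x (z N)), N => j Nj.
have xz k := gp_le_distl o x (z k).
have := hyp_le (lexx _) (le_trans (xz N) (ltW (zN _ _ (leqnn N) Nj))).
have := hyp_le (lexx _) (le_trans (xz j) (ltW (zN _ _ Nj (leqnn N)))).
by split; lra.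
Qed.

Variables (z : nat -> X) (p : X -> R).
Hypothesis zc : seq_convergent o z.
Hypothesis pz : boundary_gp_approx z p.

Lemma boundary_gp_bounds x : - delta <= p x /\ p x <= mdist x o + delta.
Proof.
have [N /(_ _ (leqnn N))] := pz x.
by have := gp_ge0 o x (z N); have := gp_le_distl o x (z N); split; lra.
Qed.

Lemma boundary_gp_hyp (a : R) y x :
  a <= p y -> a <= gp x y -> a - 3 * delta <= p x.
Proof.
move=> ay axy; have [N xN] := pz x; have [M yM] := pz y.
have [x1 x2] := xN _ (leq_maxl N M); have [y1 y2] := yM _ (leq_maxr N M).
have d0 := delta_ge0.
have axy' : a - delta <= gp x y by lra.
have ayz : a - delta <= gp y (z (maxn N M)) by lra.
by have := hyp_le axy' ayz; lra.
Qed.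

Lemma gp_boundary_hyp (a : R) x y :
  a <= p x -> a <= p y -> a - 3 * delta <= gp x y.
Proof.
move=> ax ay; have [N xN] := pz x; have [M yM] := pz y.
have [x1 x2] := xN _ (leq_maxl N M); have [y1 y2] := yM _ (leq_maxr N M).
have axz : a - delta <= gp x (z (maxn N M)) by lra.
have azy : a - delta <= gp (z (maxn N M)) y by rewrite gpC; lra.
by have := hyp_le axz azy; have := delta_ge0; lra.
Qed.

(** An isometry fixing the boundary point acts on [p] by a cocycle rule, which is
    the change of base point formula at the limit. *)
Lemma boundary_gp_isom f x : seq_equiv o (f \o z) z ->
  let q := isom_inv f o in
  p x + len f - gp x q - p q - 4 * delta <= p (f x) /\
  p (f x) <= p x + len f - gp x q - p q + 4 * delta.
Proof.
move=> /seq_equivP/(_ (mdist (f x) o))[N fz] q.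
have [N1 fx] := pz (f x); have [N2 xz] := pz x; have [N3 qz] := pz q.
pose j := maxn (maxn N N1) (maxn N2 N3).
have jN : (N <= j)%N by rewrite /j !leq_max leqnn.
have jN1 : (N1 <= j)%N by rewrite /j !leq_max leqnn !orbT.
have jN2 : (N2 <= j)%N by rewrite /j !leq_max leqnn !orbT.
have jN3 : (N3 <= j)%N by rewrite /j !leq_max leqnn !orbT.
have {fx}[fx1 fx2] := fx _ jN1.
have {xz}[xz1 xz2] := xz _ jN2.
have {qz}[qz1 qz2] := qz _ jN3.
have {fz}fzj := fz _ _ jN jN; rewrite /= in fzj.
have := gp_isom o f x (z j); rewrite -/q (gpC _ (z j) q).
have fxl := gp_le_distl o (f x).
have zfz : gp (f x) (z j) <= gp (z j) (f (z j)).
  by rewrite (gpC _ (z j)); have := fxl (z j); lra.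
have := hyp_le (lexx _) zfz.
(* f (z j) and z j agree beyond the distance from f x to o, so both have the
   same Gromov product with f x, up to delta. *)
have fzz : gp (f x) (f (z j)) <= gp (f (z j)) (z j) by have := fxl (f (z j)); lra.
have := hyp_le (lexx _) fzz.
by split; lra.
Qed.

Lemma boundary_gp_orbit f : seq_equiv o (f \o z) z ->
  let q := isom_inv f o in
  len f - p q - 5 * delta <= p (f o) /\ p (f o) <= len f - p q + 5 * delta.
Proof.
move=> fz q; have [] := boundary_gp_isom o fz; rewrite -/q.
have [] := boundary_gp_bounds o; have := gp_ge0 o o q; have := gp_le_distl o o q.
by rewrite mdistxx; split; lra.
Qed.

Variable G : set (metric_isometry X).
Hypothesis Gs : isom_semigroup G.
Hypothesis Gz : forall f, G f -> seq_equiv o (f \o z) z.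

(** A limit point other than the fixed one provides elements of [G] of large
    displacement whose orbit points stay away from the fixed point. *)
Lemma contractions_ex w : seq_convergent o w -> (forall i, orbit_of G o (w i)) ->
  ~ seq_equiv o w z ->
  exists2 c, 0 <= c & forall L, exists f, [/\ G f, L <= len f & p (f o) <= c].
Proof.
move=> /seq_equivP wc wG wz.
have [c0 c0wz] : exists t, ~ eventually_close o t w z.
  by apply/existsNP => nwz; apply/wz/seq_equivP.
have [c [c_ge0 cwz]] : exists c, 0 <= c /\ ~ eventually_close o c w z.
  exists (Num.max c0 0); split; first by rewrite le_max lexx orbT.
  by apply: contra_not c0wz; apply: eventually_close_le; rewrite le_max lexx.
have d0 := delta_ge0.
exists (c + 2 * delta) => [|L]; first by lra.
have [N wN] := wc L; have /seq_equivP/(_ c)[M zM] := zc.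
have /seq_equivP/(_ (c + delta))[M' zM'] := zc.
apply: contrapT => nf; apply: cwz; exists (maxn N M') => i j.
rewrite !geq_max => /andP[Ni _] /andP[_ Mj].
have [f Gf fw] := wG i.
have /negP : ~ p (w i) <= c + 2 * delta.
  move=> pw; apply: nf; exists f; split=> //; last by rewrite fw.
  rewrite /displacement fw; apply: ltW.
  exact: lt_le_trans (wN _ _ Ni Ni) (gp_le_distl _ _ _).
rewrite -ltNge => pw; have [K wK] := pz (w i).
have wz1 : c + delta < gp (w i) (z (maxn K M')).
  by have [+ _] := wK _ (leq_maxl K M'); lra.
by have := hyp_lt wz1 (zM' _ _ (leq_maxr K M') Mj); lra.
Qed.

(** The powers of [f] repel the fixed point: the images of [o] under their
    inverses run along a quasigeodesic ray to it, without leaving gaps longer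
    than the displacement of [f], while their images of [o] stay away from it. *)
Lemma contractions_ladder (c : R) f : 0 <= c -> G f -> p (f o) <= c ->
  2 * c + 40 * delta + 1 <= len f ->
  forall s : nat, exists h,
    [/\ G h, s%:R <= len h, len h <= s%:R + len f & p (h o) <= c + 12 * delta].
Proof.
move=> c0 Gf fc fL; have d0 := delta_ge0.
pose q := isom_inv f o; have [q1 q2] := boundary_gp_orbit (Gz Gf).
rewrite -/q in q1 q2.
have step h : G h -> p (h o) <= c + 12 * delta ->
    [/\ G (isom_comp f h), p (isom_comp f h o) <= c + 12 * delta,
        len h + 1 <= len (isom_comp f h)
      & len (isom_comp f h) <= len h + len f].
  move=> Gh hc; rewrite displacement_comp -/q.
  have gp_ub : gp (h o) q <= c + 15 * delta.
    rewrite leNgt; apply/negP => hq.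
    pose a := Num.min (gp (h o) q) (p q).
    have : a - 3 * delta <= p (h o).
      by apply: (@boundary_gp_hyp _ q); rewrite ge_min lexx ?orbT.
    have : c + 15 * delta < a by rewrite lt_min hq; lra.
    by lra.
  have gp_lb : p (h o) - 3 * delta <= gp (h o) q.
    by apply: gp_boundary_hyp; lra.
  have [_] := boundary_gp_isom (h o) (Gz Gf); rewrite -/q => fh.
  have := gp_ge0 o (h o) q.
  by split; [exact: Gs|rewrite /=; lra|lra|lra].
elim=> [|s [h [Gh sh hs hc]]].
  by exists f; split=> //; [exact: displacement_ge0|rewrite add0r|lra].
rewrite -natr1; have [hs1|hs1] := leP (s%:R + 1) (len h).
  by exists h; split=> //; lra.
have [Gfh fhc l1 l2] := step h Gh hc.
by exists (isom_comp f h); split=> //; lra.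
Qed.

(** When [G] fixes a boundary point, every [g] may both come from and go to its
    vicinity, and no finite set of multipliers helps. Multiply [g] instead by the
    element of the ladder at the height where [g o] leaves the ray to the fixed
    point. The product is not longer than [g] up to a constant, and maps [o] away
    from the fixed point; its inverse then maps [o] towards the fixed point,
    because an isometry fixing it cannot move [o] away from it in both
    directions. *)
Lemma reducible_turning_fixed_point w : seq_convergent o w ->
  (forall i, orbit_of G o (w i)) -> ~ seq_equiv o w z -> reducible_turning o G.
Proof.
move=> wc wG wz; have d0 := delta_ge0.
have [c c0 cP] := contractions_ex wc wG wz.
have [f [Gf fL fc]] := cP (2 * c + 40 * delta + 1).
have /choice[Phi PhiP] := contractions_ladder c0 Gf fc fL.
pose c1 := c + 12 * delta; pose c2 := 1 + 2 * c1 + 16 * delta.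
have l0 := displacement_ge0 o f.
have c20 : 0 <= c2 by rewrite /c2 /c1; lra.
exists (len f + 2 * c2 + 16 * delta), Phi; split; first by rewrite /c2 /c1; lra.
move=> g Gg.
have [go1 go2] := boundary_gp_bounds (g o); rewrite -/(len g) in go2.
have g0 := displacement_ge0 o g.
have pd0 : 0 <= p (g o) + delta by lra.
(* p (g o) is at least - delta, hence the shift before rounding. *)
exists (Num.truncn (p (g o) + delta)).
have /andP[s1 s2] := Num.Theory.truncn_itv pd0; rewrite -natr1 in s2.
set s := Num.truncn _ in s1 s2 *; have [Gh hs1 hs2 hc] := PhiP s.
move: (Phi s) => h in Gh hs1 hs2 hc *.
pose q := isom_inv h o; have [q1 q2] := boundary_gp_orbit (Gz Gh).
rewrite -/q in q1 q2.
have gq : s%:R - c1 - 8 * delta <= gp (g o) q.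
  have -> : s%:R - c1 - 8 * delta = s%:R - c1 - 5 * delta - 3 * delta by lra.
  by apply: gp_boundary_hyp; rewrite /c1; lra.
pose a := isom_comp h g; have Ga : G a := Gs Gh Gg.
have la : len a = len h + len g - 2 * gp (g o) q by exact: displacement_comp.
have pa : p (a o) <= c2.
  have [_ ] := boundary_gp_isom (g o) (Gz Gh); rewrite -/q /a /= /c2.
  by rewrite /c1 in gq *; lra.
have [a1 a2] := boundary_gp_orbit (Gz Ga).
have a3 := gp_le_distl o (a o) (isom_inv a o); rewrite -/(len a) in a3.
have ga : gp (a o) (isom_inv a o) <= 2 * c2 + 8 * delta.
  rewrite leNgt; apply/negP => big.
  pose b := Num.min (gp (a o) (isom_inv a o)) (p (isom_inv a o)).
  have : b - 3 * delta <= p (a o).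
    by apply: (@boundary_gp_hyp _ (isom_inv a o)); rewrite ge_min lexx ?orbT.
  have : c2 + 3 * delta < b by rewrite lt_min; apply/andP; split; lra.
  by lra.
split=> //; rewrite -/a ?la; rewrite /c2 /c1 in ga gq *; lra.
Qed.

End fixed_point.

Section turning.
Context {R : realType} {X : metricType R} (o : X) (delta : R).

Local Notation gp := (gromov_product o).

Hypothesis delta_ge0 : 0 <= delta.
Hypothesis hypX : forall x y y', Num.min (gp x y) (gp y y') - delta <= gp x y'.

Lemma limit_set_two_sequences (G : set (metric_isometry X)) xi eta :
  limit_set G o xi -> limit_set G o eta -> xi <> eta ->
  exists u v, [/\ seq_convergent o u /\ (forall i, orbit_of G o (u i)),
    seq_convergent o v /\ (forall i, orbit_of G o (v i)) & ~ seq_equiv o u v].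
Proof.
move=> [u uG <-] [v vG <-] uv; exists u, v; split=> // euv; apply: uv.
apply/seteqP; split=> w [wc ew]; split=> //.
  by apply: (seq_equiv_trans hypX) ew; apply: seq_equiv_sym.
exact: (seq_equiv_trans hypX) euv ew.
Qed.

Lemma reducible_turning_limit_set (G : set (metric_isometry X)) u v (C : R) :
  compact_boundary o -> isom_semigroup G ->
  0 <= C -> (forall g, exists theta, points_towards o C theta g) ->
  seq_convergent o u -> (forall i, orbit_of G o (u i)) ->
  seq_convergent o v -> (forall i, orbit_of G o (v i)) ->
  ~ seq_equiv o u v -> reducible_turning o G.
Proof.
move=> cB Gs C0 dir uc uG vc vG uv.
have [[z [zc zG]]|nfix] := pselect (exists z, seq_convergent o z /\
    forall f, G f -> seq_equiv o (f \o z) z).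
  have [p pz] := boundary_gp_approx_ex hypX zc.
  have [uz|uz] := pselect (seq_equiv o u z).
    apply: (reducible_turning_fixed_point delta_ge0 hypX zc pz Gs zG vc vG).
    by move=> /seq_equiv_sym zv; apply: uv; apply: (seq_equiv_trans hypX) zv.
  exact: (reducible_turning_fixed_point delta_ge0 hypX zc pz Gs zG uc uG).
apply: (reducible_turning_no_fixed_point delta_ge0 hypX C0) => // z zc.
apply: contrapT => nf; apply: nfix; exists z; split=> // f Gf.
by apply: contrapT => fz; apply: nf; exists f.
Qed.

End turning.

(** * Growth and Schottky families *)

Section growth.
Context {R : realType} {X : metricType R} (o : X).
Local Notation growth := (growth_exponent o).

Lemma counting_ge0 (A : set X) : (0 <= counting A :> \bar R)%E.
Proof. by rewrite /counting; case: ifP => // _; rewrite lee_fin. Qed.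

Lemma counting_ge_size (A : set X) (s : seq X) : uniq s ->
  (forall x, x \in s -> A x) -> ((size s)%:R%:E <= counting A :> \bar R)%E.
Proof.
move=> us sA; rewrite /counting; case: ifPn => [/asboolP Afin|_]; last exact: leey.
rewrite lee_fin ler_nat; apply: uniq_leq_size => // x /sA Ax.
by rewrite in_fset_set ?inE.
Qed.

Lemma counting_gt_size (A : set X) (t : R) : 0 < t -> (t%:E < counting A)%E ->
  exists s : seq X, [/\ uniq s, forall x, x \in s -> A x & t < (size s)%:R].
Proof.
move=> t0; rewrite /counting; case: ifPn => [/asboolP Afin|/asboolP Ainf].
  rewrite lte_fin => tA; exists (finmap.enum_fset (fset_set A)); split=> //; first exact: finmap.fset_uniq.
  by move=> x; rewrite in_fset_set// inE.
move=> _; have [B BA Bt] := infinite_set_fset (Num.truncn t).+1 Ainf.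
exists (finmap.enum_fset B); split; [exact: finmap.fset_uniq| |]; first by move=> x xB; apply: BA.
have /andP[_ /lt_le_trans] := Num.Theory.truncn_itv (ltW t0); apply.
by rewrite ler_nat.
Qed.

Lemma le_growth_exponent (c : R) (P : set X) :
  (forall n0, exists n s, [/\ (n0 <= n)%N, (0 < n)%N, uniq s,
     forall x, x \in s -> (ball o n%:R `&` P) x &
     (0 < size s)%N /\ c * n%:R <= ln (size s)%:R]) ->
  (c%:E <= growth P)%E.
Proof.
move=> cP; apply: le_ereal_inf_tmp => _ [V [n0 _ n0V] <-].
have [n [s [n0n n1 us sP [s0 cs]]]] := cP n0.
apply: le_ereal_sup_tmp; exists ((n%:R^-1)%:E * lne (counting (ball o n%:R `&` P)))%E.
  by exists n => //; apply: n0V.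
have n1' : 0 < n%:R :> R by rewrite ltr0n.
apply: (@le_trans _ _ ((n%:R^-1)%:E * (ln (size s)%:R)%:E)%E).
  by rewrite -EFinM lee_fin mulrC ler_pdivlMr.
apply: lee_wpmul2l; first by rewrite lee_fin invr_ge0 ltW.
have s0' : 0 < (size s)%:R :> R by rewrite ltr0n.
rewrite -lne_EFin// lee_lne ?in_itv/= ?leey ?andbT ?counting_ge0//.
exact: counting_ge_size.
Qed.

Lemma lt_growth_exponent (c : R) (P : set X) : (c%:E < growth P)%E ->
  forall n0, exists n s, [/\ (n0 <= n)%N, uniq s,
     forall x, x \in s -> (ball o n%:R `&` P) x & expR (c * n%:R) < (size s)%:R].
Proof.
move=> cP n0.
have : (c%:E < ereal_sup [set ((n%:R^-1)%:E * lne (counting (ball o n%:R `&` P)))%E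
    | n in [set n | (n0.+1 <= n)%N]])%E.
  apply: lt_le_trans cP _; apply: ge_ereal_inf.
  by eexists; [exists [set n | (n0.+1 <= n)%N]; [exists n0.+1|reflexivity]|].
move=> /ereal_sup_gt[_ [n n0n <-]] cn; exists n.
have n1 : 0 < n%:R :> R by rewrite ltr0n (leq_trans _ n0n).
have {cn} : ((expR (c * n%:R))%:E < counting (ball o n%:R `&` P))%E.
  rewrite -lte_lne ?in_itv/= ?leey ?andbT ?counting_ge0 ?lee_fin ?expR_ge0//.
  rewrite leNgt expR_gt0 /= expRK EFinM.
  by rewrite muleC in cn; rewrite -lte_pdivlMr.
move=> /counting_gt_size[|s [us sP cs]]; first exact: expR_gt0.
by exists s; split=> //; exact: ltnW.
Qed.

Lemma le_entropy (c : R) (P S : set X) : separated_set S -> P !=set0 ->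
  (c%:E <= growth (P `&` S))%E -> (c%:E <= entropy o P)%E.
Proof.
move=> Ssep [x Px] cP; rewrite /entropy; case: ifPn => [/asboolP P0|_].
  by move: Px; rewrite P0.
by apply: le_ereal_sup_tmp; exists (growth (P `&` S)) => //; exists S.
Qed.

Lemma entropy_ge0 (P : set X) : P !=set0 -> (0 <= entropy o P)%E.
Proof.
move=> [x Px]; apply: (@le_entropy 0 P [set x]); [|by exists x|].
  by exists 1 => // y z -> ->.
apply: le_growth_exponent => n0.
pose n := (maxn n0 (Num.truncn (mdist o x)).+1); exists n, [:: x]; split=> //.
- exact: leq_maxl.
- by rewrite /n leq_max ltnS leq0n orbT.
- move=> y; rewrite inE => /eqP ->; split=> //; rewrite ballEmdist/=.
  have /andP[_ /lt_le_trans] := Num.Theory.truncn_itv (mdist_ge0 o x); apply.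
  by rewrite ler_nat leq_maxr.
- by rewrite mul0r ln1.
Qed.

End growth.

Section schottky.
Context {R : realType} {X : metricType R} (o : X) (delta : R).
Implicit Types (x y z : X) (g h : metric_isometry X).

Local Notation gp := (gromov_product o).
Local Notation len := (displacement o).

Hypothesis delta_ge0 : 0 <= delta.
Hypothesis hypX : forall x y z, Num.min (gp x y) (gp y z) - delta <= gp x z.

Let hyp_lt := gp_hyp_lt hypX.
Let hyp_le := gp_hyp hypX.

(** All inequalities are strict, so that the condition is open in the family.
    The isometries have nearly equal displacements, so that none of them can lie
    on the way to another one; the separation constant is what
    [word_point_separated] requires. *)
Definition schottky (C : R) (r N : nat) (a : 'I_N -> metric_isometry X) :=
  [/\ forall i, r%:R - 1 < len (a i) /\ len (a i) < r%:R + 1,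
      forall i j, gp (isom_inv (a i) o) (a j o) < C
    & forall i j, i <> j ->
        2 * C + 6 * delta + 5 < mdist (a i o) (a j o)].

Section words.
Variables (C : R) (r N : nat) (a : 'I_N -> metric_isometry X).
Hypothesis C_ge0 : 0 <= C.
Hypothesis r_large : 2 * C + 2 * delta + 2 <= r%:R.
Hypothesis Sa : schottky C r a.

Definition word_point (w : seq 'I_N) : X := foldr (fun i => a i) o w.

Lemma letter_word_point i w : gp (word_point w) (isom_inv (a i) o) <= C + delta ->
  len (a i) - (C + delta) <= gp (a i o) (word_point (i :: w)).
Proof. by move=> iw; rewrite gp_isom_origin lerB. Qed.

(** The local condition on consecutive letters propagates to words: seen from
    [o], the point of a word lies in the direction of its first letter. *)
Lemma gp_word_point_inv i w : gp (word_point w) (isom_inv (a i) o) <= C + delta.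
Proof.
have [len_a turn_a _] := Sa; have d0 := delta_ge0; have C0 := C_ge0.
elim: w i => [|j w IH] i.
  by rewrite (le_trans (gp_le_distl _ _ _))// mdistxx; lra.
rewrite leNgt; apply/negP => ijw.
have /letter_word_point jw := IH j.
have : C + delta < gp (a j o) (word_point (j :: w)).
  by have [lj _] := len_a j; have := r_large; lra.
by move=> /hyp_lt/(_ ijw); have := turn_a i j; rewrite gpC; lra.
Qed.

Lemma gp_first_letter i w :
  r%:R - 1 - (C + delta) < gp (a i o) (word_point (i :: w)).
Proof.
have [len_a _ _] := Sa; have [li _] := len_a i.
by have := letter_word_point (gp_word_point_inv i w); lra.
Qed.

Lemma word_point_far i w : 1 <= mdist (word_point (i :: w)) o.
Proof.
have := gp_first_letter i w; have := gp_le_distr o (a i o) (word_point (i :: w)).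
by have := r_large; have := delta_ge0; have := C_ge0; lra.
Qed.

Lemma word_point_near i w :
  mdist (word_point (i :: w)) o < (size w).+1%:R * (r.+1)%:R.
Proof.
have [len_a _ _] := Sa.
elim: w i => [|j w IH] i.
  by rewrite mul1r -natr1; have [] := len_a i.
have := metric_triangle (word_point [:: i, j & w]) (a i o) o.
rewrite -/(len _) [X in X + _](isom_mdist (a i)) => t.
apply: le_lt_trans t _; rewrite [X in _ < X%:R * _]/= -[X in _ < X * _]natr1.
rewrite mulrDl mul1r; apply: ltrD; first exact: IH.
by have [_] := len_a i; rewrite natr1.
Qed.

(** After removing a common prefix by an isometry, the words start with
    different letters; their points lie in the directions of these letters, which
    diverge before the distance [r]. *)
Lemma word_point_separated w w' : w <> w' ->
  1 <= mdist (word_point w) (word_point w').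
Proof.
elim: w w' => [|i w IH] [|j w'] //.
- by move=> _; rewrite metric_sym; exact: word_point_far.
- by move=> _; exact: word_point_far.
have [<- ww'|ij _] := pselect (i = j).
  by rewrite /= isom_mdist; apply: IH => ww'E; apply: ww'; rewrite ww'E.
have [len_a _ /(_ _ _ ij) dij] := Sa.
have [_ li] := len_a i; have [_ lj] := len_a j.
have gi := gp_first_letter i w; have gj := gp_first_letter j w'.
have xi := gp_le_distr o (a i o) (word_point (i :: w)).
have yj := gp_le_distr o (a j o) (word_point (j :: w')).
set x := word_point _ in gi xi *; set y := word_point _ in gj yj *.
have d0 := delta_ge0; have C0 := C_ge0.
have : gp (a i o) (a j o) < r%:R - 1 - (C + delta) - 2 * delta - 1 / 2.
  by rewrite /gromov_product -/(len (a i)) -/(len (a j)); lra.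
have [xy|xy] := leP (gp x y) (r%:R - 1 - (C + delta)); last first.
  have := hyp_lt gi xy; rewrite gpC in gj.
  move=> e1; have e2 : r%:R - 1 - (C + delta) - delta < gp y (a j o) by lra.
  by have := hyp_lt e1 e2; lra.
have e1 := hyp_le (le_trans xy (ltW gi)) (lexx _).
have e2 : gp x y - delta <= gp y (a j o) by rewrite gpC in gj; lra.
have := hyp_le e1 e2.
by rewrite (mdist_gp o x y) /gromov_product -/(len (a i)) -/(len (a j)); lra.
Qed.

Lemma word_point_orbit (G : set (metric_isometry X)) i w :
  isom_semigroup G -> (forall i, G (a i)) -> orbit_of G o (word_point (i :: w)).
Proof.
move=> Gs Ga; elim: w i => [|j w IH] i; first by exists (a i).
by have [g Gg go] := IH j; exists (isom_comp (a i) g); [exact: Gs|rewrite /= go].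
Qed.

End words.

(** The words of length [k] give [N ^ k] uniformly separated orbit points at
    distance less than [k * (r + 1)]. *)
Lemma schottky_entropy (G : set (metric_isometry X)) (C : R) (r N : nat)
    (a : 'I_N -> metric_isometry X) :
  0 <= C -> 2 * C + 2 * delta + 2 <= r%:R -> (0 < N)%N ->
  schottky C r a -> isom_semigroup G -> (forall i, G (a i)) ->
  ((ln N%:R / (r.+1)%:R)%:E <= isom_entropy o G)%E.
Proof.
move=> C0 rC N0 Sa Gs Ga.
apply: (@le_entropy _ _ _ _ _ (range (word_point a))).
- exists (1 / 2) => [|_ _ [w _ <-] [w' _ <-] ww']; first by lra.
  have /(word_point_separated C0 rC Sa) : w <> w'.
    by move=> e; apply: ww'; rewrite e.
  by lra.
- by exists (a (Ordinal N0) o); exists (a (Ordinal N0)).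
apply: le_growth_exponent => n0.
have winj : injective (word_point a).
  move=> w w' ww'; apply: contrapT => /(word_point_separated C0 rC Sa).
  by rewrite ww' mdistxx; lra.
pose k := n0.+1.
exists (k * r.+1)%N, [seq word_point a (tval w) | w <- enum {: k.-tuple 'I_N}].
have kr : (n0 < k * r.+1)%N by rewrite -[n0.+1]muln1 leq_mul.
split.
- exact: ltnW.
- exact: leq_ltn_trans kr.
- by rewrite map_inj_uniq ?enum_uniq// => w w' /winj/val_inj.
- move=> _ /mapP[[w wk] _ ->] /=.
  case: w wk => // i w /eqP[wk]; split; last first.
    by split; [exact: word_point_orbit|exists (i :: w)].
  rewrite ballEmdist /= metric_sym natrM /k -wk.
  exact: (word_point_near Sa).
- rewrite size_map -cardT card_tuple card_ord expn_gt0 N0; split=> //.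
  rewrite natrX lnXn ?ltr0n// natrM [k%:R * _]mulrC mulrA divfK ?pnatr_eq0//.
  by rewrite mulr_natr.
Qed.

End schottky.

(** * Selecting subfamilies *)

Section finite_selection.

Lemma sum_class_card (T C : finType) (A : {set T}) (f : T -> C) (Q : pred C) :
  (forall x, x \in A -> Q (f x)) ->
  #|A| = (\sum_(c | Q c) #|[set x in A | f x == c]|)%N.
Proof.
move=> AQ; rewrite -sum1_card (partition_big f Q)//=.
by apply: eq_bigr => c _; rewrite -sum1_card; apply: eq_bigl => x; rewrite inE.
Qed.

Lemma pigeonhole_class (T : finType) (A : {set T}) (m : nat) (f : T -> nat) :
  (0 < m)%N -> (forall x, (f x < m)%N) ->
  exists c, (#|A| <= m * #|[set x in A | f x == c]|)%N.
Proof.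
move=> m0 fm.
pose F x : 'I_m := Ordinal (fm x).
pose K (c : 'I_m) := #|[set x in A | F x == c]|.
pose c := [arg max_(c > Ordinal m0) K c].
exists (nat_of_ord c); rewrite (@sum_class_card _ _ A F xpredT)//.
rewrite -[m in (m * _)%N]card_ord -sum_nat_const; apply: leq_sum => d _.
by rewrite /c; case: arg_maxnP => // e _ /(_ d isT).
Qed.

(** A separated subset of maximal cardinality is [D]-dense. *)
Lemma separated_subset (R : realType) (X : metricType R) (T : finType)
    (A : {set T}) (p : T -> X) (D : R) (M : nat) : 0 <= D ->
  (forall y, y \in A -> (#|[set x in A | (mdist (p x) (p y) <= D)%R]| <= M)%N) ->
  exists B : {set T}, [/\ B \subset A, (#|A| <= #|B| * M)%N &
    forall x y, x \in B -> y \in B -> x <> y -> D < mdist (p x) (p y)].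
Proof.
move=> D0 AM.
pose P (B : {set T}) := (B \subset A) &&
  [forall x in B, forall y in B, (x != y) ==> (D < mdist (p x) (p y))].
have P0 : P finset.set0.
  by rewrite /P finset.sub0set; apply/forallP => x; rewrite inE.
case: (@arg_maxnP _ finset.set0 P (fun B => #|B|) P0) => B /andP[BA].
move=> /'forall_in_'forall_in_implyP Bsep Bmax.
have {}Bsep x y : x \in B -> y \in B -> x <> y -> D < mdist (p x) (p y).
  by move=> xB yB xy; apply: Bsep => //; apply/eqP.
have near x : x \in A -> exists y, y \in B /\ mdist (p x) (p y) <= D.
  move=> xA; apply: contrapT => nx.
  have far y : y \in B -> D < mdist (p x) (p y).
    by move=> yB; rewrite ltNge; apply/negP => xy; apply: nx; exists y.
  have xB : x \notin B by apply/negP => /far; rewrite mdistxx ltNge D0.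
  have /Bmax : P (x |: B).
    rewrite /P finset.subUset finset.sub1set xA BA; apply/'forall_in_'forall_in_implyP => y + z.
    rewrite !finset.in_setU1 => /predU1P[->|yB] /predU1P[->|zB] /eqP yz //.
    - exact: far.
    - by rewrite metric_sym; apply: far.
    - exact: Bsep.
  by rewrite /= finset.cardsU1 xB add1n /geq /= ltnn.
have /choice[c cP] x : exists y, x \in A -> y \in B /\ mdist (p x) (p y) <= D.
  by have [/near[y]|xA] := boolP (x \in A); [exists y|exists x].
exists B; split=> //.
rewrite (@sum_class_card _ _ A c (mem B)) => [|x /cP[]//].
rewrite -sum_nat_const; apply: leq_sum => y yB.
apply: leq_trans (AM y _); last exact: (fintype.subsetP BA).
apply: subset_leq_card; apply/fintype.subsetP => x; rewrite !inE.
by move=> /andP[xA /eqP <-]; rewrite xA; have [] := cP x xA.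
Qed.

End finite_selection.

Section selection.
Context {R : realType} {X : metricType R} (o : X).
Implicit Types (x y : X) (g : metric_isometry X).

(** A proper space need not have bounded geometry, but the balls centered at the
    orbit points are all isometric to balls centered at [o]. *)
Lemma separated_card_bound (e D : R) : proper_space X -> 0 < e ->
  exists M : nat, forall (T : finType) (A : {set T}) (p : T -> X) g,
    (forall t u, t \in A -> u \in A -> t <> u -> e < mdist (p t) (p u)) ->
    (forall t, t \in A -> mdist (p t) (g o) <= D) -> (#|A| <= M)%N.
Proof.
move=> Xproper e0.
have [x _|l lP] := compact_finite_cover (Xproper o D) (U := ball^~ (e / 2)).
  by apply: nbhsx_ballx; rewrite divr_gt0.
exists (size l).+1 => T A p g sep pD.
have /choice[c cP] t : exists x, t \in A ->
    x \in l /\ mdist x (isom_inv g (p t)) < e / 2.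
  have [tA|_] := boolP (t \in A); last by exists o.
  have [|x [xl _ xt]] := lP (isom_inv g (p t)).
    by rewrite /= -mdist_isom_swap metric_sym pD.
  by exists x => _; split=> //; move: xt; rewrite ballEmdist.
rewrite -[(size l).+1]card_ord.
apply: (@leq_card_in _ _ (fun t => inord (index (c t) l) : 'I_(size l).+1)).
move=> t u tA uA; have [tl ct] := cP t tA; have [ul cu] := cP u uA.
move=> /(congr1 val); rewrite /= !inordK ?ltnS ?index_size// => tu.
have {tu} ctu : c t = c u by rewrite -(nth_index o tl) tu nth_index.
apply: contrapT => /(sep _ _ tA uA); apply/negP; rewrite -leNgt.
rewrite -(isom_inv_mdist g).
have := metric_triangle (isom_inv g (p t)) (c t) (isom_inv g (p u)).
by rewrite (metric_sym _ (c t)) {2}ctu; lra.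
Qed.

Lemma exp_dominates_quadratic (h h' K : R) (q : nat) : h' < h -> 0 <= K ->
  exists n0, forall n, (n0 <= n)%N ->
    K * (n + q)%:R ^+ 2 * expR (h' * (n + q)%:R) <= expR (h * n%:R).
Proof.
move=> hh K0; pose k := h - h'; have k0 : 0 < k by rewrite subr_gt0.
pose L := K * expR (h * q%:R) * 6 / k ^+ 3.
have L0 : 0 <= L by rewrite !mulr_ge0// ?expR_ge0// invr_ge0 exprn_ge0// ltW.
exists (Num.truncn L).+1 => n nL; set y := (n + q)%:R : R.
have y0 : 0 <= y by [].
have yL : L <= y.
  have /andP[_ /ltW/le_trans] := Num.Theory.truncn_itv L0; apply.
  by rewrite ler_nat (leq_trans nL)// leq_addr.
(* The exponential dominates the cubic term of its series, and the bound L is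
   what the cubic term needs to exceed the left-hand side. *)
have : K * expR (h * q%:R) * y ^+ 2 <= expR (k * y).
  have := @expR_ge1Dxn _ (k * y) 2 (mulr_ge0 (ltW k0) y0).
  apply: le_trans.
  have -> : (3`!)%:R = 6 :> R by [].
  have {1}-> : K * expR (h * q%:R) = L * k ^+ 3 / 6.
    by rewrite /L mulfVK ?expf_neq0 ?gt_eqF// mulfK.
  have M0 : 0 <= k ^+ 3 * y ^+ 2 / 6.
    by rewrite !mulr_ge0// ?exprn_ge0// ltW.
  have := ler_wpM2r M0 yL; rewrite exprMn [y ^+ 3]exprS.
  by move: (k ^+ 3) (y ^+ 2) => k3 y2; lra.
have -> : h * n%:R = k * y + h' * y - h * q%:R.
  by rewrite /y /k natrD; lra.
rewrite expRD expRN ler_pdivlMr ?expR_gt0// expRD => ky.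
rewrite mulrAC ler_wpM2r ?expR_ge0//; apply: le_trans ky.
by rewrite mulrAC.
Qed.

End selection.

(** * Schottky families in a semigroup and their perturbations *)

Section schottky_ex.
Context {R : realType} {X : metricType R} (o : X) (delta : R).
Implicit Types (x y z : X) (g h : metric_isometry X).

Local Notation gp := (gromov_product o).
Local Notation len := (displacement o).

Hypothesis delta_ge0 : 0 <= delta.
Hypothesis hypX : forall x y z, Num.min (gp x y) (gp y z) - delta <= gp x z.

Let hyp_le := gp_hyp hypX.

(** Start from a large separated set of orbit points in the ball of radius [n],
    and make their isometries turn by a bounded amount. By the pigeonhole
    principle, many of them have the same multiplier, the same displacement up to
    [1], and nearly the same direction. Bounded turning of each one then gives
    bounded turning from each one to any other one. Thinning out to a coarser
    separation only costs a constant factor. The losses are quadratic in [n],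
    hence negligible against the difference of the exponents. *)
Lemma schottky_ex (G : set (metric_isometry X)) (A : R) (S : set X) (h h' : R) :
  proper_space X -> reducible_turning o G -> 0 <= A ->
  (forall t : R, exists (m : nat) (color : metric_isometry X -> nat),
    (forall g, (color g < m)%N) /\
    forall g g' a, color g = color g' -> a <= len g -> a <= len g' -> a <= t ->
      a - A <= gp (g o) (g' o)) ->
  separated_set S -> 0 <= h' -> h' < h ->
  (h%:E < growth_exponent o (orbit_of G o `&` S))%E ->
  exists (C : R) (r N : nat) (a : 'I_N -> metric_isometry X),
    [/\ 0 <= C /\ 2 * C + 2 * delta + 2 <= r%:R, (0 < N)%N,
        schottky o delta C r a, forall i, G (a i)
      & h' * (r.+1)%:R <= ln N%:R].
Proof.
move=> Xproper [c [Phi [c0 PhiP]]] A0 coloring [e e0 Se] h'0 hh hG.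
have d0 := delta_ge0.
pose C := c + delta + 1; pose t := A + c + delta + 1.
pose D := 2 * C + 6 * delta + 5; pose L := 2 * C + 2 * delta + 2 + t.
have C0 : 0 <= C by rewrite /C; lra.
have D0 : 0 <= D by rewrite /D; lra.
have t0 : 0 <= t by rewrite /t; lra.
have [m [color [colorm colorP]]] := coloring t.
have m0 : (0 < m)%N by apply: leq_ltn_trans (colorm isom_id).
have [M1 M1P] := separated_card_bound o D Xproper e0.
have [M2 M2P] := separated_card_bound o (L + 1) Xproper e0.
pose q := (Num.truncn c).+1.
have cq : c < q%:R by have /andP[] := Num.Theory.truncn_itv c0.
pose K := (m * (M1 + M2).+1)%N.
(* q bounds the additive increase of the displacements, and m, M1 and M2 the
   losses coming from the directions, the thinning and the short elements. *)
have [n0 n0P] := @exp_dominates_quadratic _ h h' K%:R q hh (ler0n _ _).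
have [n [s [n0n us sP sN]]] := lt_growth_exponent hG n0.
have {n0 n0n n0P}nP := n0P _ n0n.
set T := 'I_(size s).
have /choice[g gP] (i : T) : exists g, G g /\ g o = nth o s i.
  by have [_ [[g Gg go] _]] := sP _ (mem_nth o (ltn_ord i)); exists g.
have glen i : len (g i) < n%:R.
  have [+ _] := sP _ (mem_nth o (ltn_ord i)); rewrite ballEmdist/= metric_sym.
  by rewrite /displacement; have [_ ->] := gP i.
have gsep i j : i <> j -> e < mdist (g i o) (g j o).
  have [_ ->] := gP i; have [_ ->] := gP j => ij.
  have [_ [_ Si]] := sP _ (mem_nth o (ltn_ord i)).
  have [_ [_ Sj]] := sP _ (mem_nth o (ltn_ord j)).
  by apply: Se => // /eqP; rewrite nth_uniq// => /eqP/val_inj.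
have /choice[k kP] i := PhiP _ (gP i).1.
pose a i := isom_comp (Phi (k i)) (g i).
have nq : 0 <= n%:R + q%:R :> R by [].
have knq i : (k i < n + q)%N.
  by have [ki _ _ _] := kP i; rewrite -(ltr_nat R) natrD; have := glen i; lra.
have anq i : len (a i) < n%:R + q%:R.
  by have [_ _ ai _] := kP i; have := glen i; rewrite -/(a i) in ai; lra.
pose rho i := Num.truncn (len (a i)).
have rhoP i : (rho i)%:R <= len (a i) /\ len (a i) < (rho i)%:R + 1.
  have /andP[] := Num.Theory.truncn_itv (displacement_ge0 o (a i)).
  by rewrite -natr1.
have rhonq i : (rho i < n + q)%N.
  by rewrite -(ltr_nat R) natrD; have := anq i; have [] := rhoP i; lra.
have nq0 : (0 < n + q)%N by rewrite /q addnS.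
(* Three successive choices: the multiplier, the rounded displacement and the
   direction. *)
have [k0 k0P] := pigeonhole_class (finset.setTfor T) nq0 knq.
have [r rP] := pigeonhole_class [set i in finset.setTfor T | k i == k0] nq0 rhonq.
set A2 := [set i in _ | rho i == r] in rP.
have [d dP] := pigeonhole_class A2 m0 (fun i => colorm (a i)).
set A3 := [set i in _ | color (a i) == d] in dP.
have A3P i : i \in A3 -> [/\ k i = k0, rho i = r & color (a i) = d].
  by rewrite !inE => /andP[/andP[/eqP-> /eqP->] /eqP->].
have asep i j : i \in A3 -> j \in A3 -> i <> j -> e < mdist (a i o) (a j o).
  move=> /A3P[ki _ _] /A3P[kj _ _] ij.
  by rewrite /a /= ki kj isom_mdist; apply: gsep.
have sA3 : (size s <= (n + q) * ((n + q) * (m * #|A3|)))%N.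
  have := k0P; rewrite cardsT card_ord => /leq_trans; apply.
  rewrite leq_mul2l; apply/orP; right; apply: leq_trans rP _.
  by rewrite leq_mul2l dP orbT.
pose E := expR (h' * (n + q)%:R).
have E1 : 1 <= E by rewrite -expR0 ler_expR mulr_ge0.
have A3E : (M1 + M2).+1%:R * E < #|A3|%:R.
  have : (size s)%:R <= ((n + q) * ((n + q) * (m * #|A3|)))%:R :> R.
    by rewrite ler_nat.
  move=> /(lt_le_trans sN)/(le_lt_trans nP).
  rewrite /K !natrM -/E expr2.
  have P0 : 0 < m%:R * (n + q)%:R * (n + q)%:R :> R by rewrite !mulr_gt0 ?ltr0n.
  have -> : m%:R * (M1 + M2).+1%:R * ((n + q)%:R * (n + q)%:R) * E =
    (m%:R * (n + q)%:R * (n + q)%:R) * ((M1 + M2).+1%:R * E) by lra.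
  have -> : (n + q)%:R * ((n + q)%:R * (m%:R * #|A3|%:R)) =
    (m%:R * (n + q)%:R * (n + q)%:R) * #|A3|%:R :> R by lra.
  by rewrite ltr_pM2l.
have E0 : 0 < E by exact: expR_gt0.
have M1E : 0 <= M1%:R * (E - 1) by rewrite mulr_ge0// subr_ge0.
have M2E : 0 <= M2%:R * (E - 1) by rewrite mulr_ge0// subr_ge0.
rewrite -natr1 natrD in A3E.
(* There are too many elements left for all of them to be short. *)
have rL : L <= r%:R.
  rewrite leNgt; apply/negP => rL; have : (#|A3| <= M2)%N.
    apply: (M2P _ _ (fun i => a i o) isom_id) => //= i /A3P[_ ir _].
    by have [_] := rhoP i; rewrite ir -/(len (a i)); lra.
  rewrite -(ler_nat R) => A3M2.
  have M10 : 0 <= M1%:R :> R by [].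
  by lra.
have [y yA3|B [BA3 A3B Bsep]] :=
  separated_subset (p := fun i => a i o) (M := M1) D0 (A := A3).
  apply: (M1P _ _ (fun i => a i o) (a y)) => [i j|i].
    by rewrite inE => /andP[iA _]; rewrite inE => /andP[jA _]; exact: asep.
  by rewrite inE => /andP[].
have EB : E < #|B|%:R.
  rewrite -(ler_nat R) natrM in A3B; rewrite ltNge; apply/negP => BE.
  have : #|B|%:R * M1%:R <= E * M1%:R :> R by rewrite ler_wpM2r.
  have : 0 <= M2%:R :> R by [].
  by lra.
have rnq : (r.+1 <= n + q)%N.
  have : (0 < #|A3|)%N.
    rewrite -(ltr_nat R); apply: le_lt_trans A3E.
    by rewrite -natrD natr1 mulr_ge0// ltW.
  by move=> /card_gt0P[i /A3P[_ ir _]]; rewrite -ir; exact: rhonq.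
exists C, r, #|B|, (fun i => a (enum_val i)).
have BP i : i \in B -> [/\ len (a i) < r%:R + 1, r%:R <= len (a i),
    color (a i) = d & i \in A3].
  by move=> /(fintype.subsetP BA3) iA3; have [_ <- cd] := A3P _ iA3; have [] := rhoP i.
split.
- by split=> //; rewrite /L in rL; lra.
- by rewrite -(ltr_nat R) (lt_trans E0).
- split=> [i|i j|i j ij].
  + by have [l1 l2 _ _] := BP _ (enum_valP i); split; lra.
  (* The inverse of the first one sends o away from where the first one sends
     it, which is where the second one sends it. *)
  + have [_ ri ci _] := BP _ (enum_valP i); have [_ rj cj _] := BP _ (enum_valP j).
    have : t - A <= gp (a (enum_val j) o) (a (enum_val i) o).
      by apply: colorP; rewrite ?ci ?cj//; rewrite /L in rL; lra.
    have -> : t - A = C by rewrite /t /C; lra.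
    move=> ji; rewrite ltNge; apply/negP => ij; have := hyp_le ij ji.
    have [_ _ _] := kP (enum_val i).
    by rewrite -/(a _) gpC /C; lra.
  + apply: Bsep; [exact: enum_valP|exact: enum_valP|].
    by move=> /enum_val_inj.
- by move=> i; have [] := kP (enum_val i).
- have lnE : h' * (n + q)%:R <= ln #|B|%:R.
    rewrite -[leLHS]expRK ler_ln ?posrE ?expR_gt0//; first exact: ltW.
    exact: lt_trans E0 EB.
  by apply: le_trans lnE; rewrite ler_wpM2l// ler_nat.
Qed.

(** The condition consists of strict inequalities between distances of finitely
    many points, the images of [o] under the isometries and their inverses. *)
Lemma schottky_near (C : R) (r N : nat) (a : 'I_N -> metric_isometry X)
    (b : 'I_N -> nat -> metric_isometry X) :
  schottky o delta C r a -> (forall i, isom_cvg \oo (b i) (a i)) ->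
  \forall n \near \oo, schottky o delta C r (b^~ n).
Proof.
move=> [len_a turn_a sep_a] ba.
have nearb i e : 0 < e -> \forall n \near \oo, mdist (a i o) (b i n o) < e.
  move=> e0; have [+ _] := ba i [set o] (@compact_set1 _ o).
  by rewrite uniform_set1 => /metricType_numDomainType.cvgrPdist_lt/(_ _ e0).
have nearbV i e : 0 < e ->
    \forall n \near \oo, mdist (isom_inv (a i) o) (isom_inv (b i n) o) < e.
  move=> e0; have [_] := ba i [set o] (@compact_set1 _ o).
  by rewrite uniform_set1 => /metricType_numDomainType.cvgrPdist_lt/(_ _ e0).
have e1 : \forall n \near \oo, forall i,
    r%:R - 1 < len (b i n) /\ len (b i n) < r%:R + 1.
  apply: filter_forall => i; have [l1 l2] := len_a i.
  pose e := Num.min (len (a i) - (r%:R - 1)) (r%:R + 1 - len (a i)).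
  have e0 : 0 < e by rewrite lt_min !subr_gt0 l1 l2.
  apply: filterS (nearb i _ e0) => n; rewrite lt_min => /andP[n1 n2].
  have := metric_triangle (a i o) (b i n o) o.
  have := metric_triangle (b i n o) (a i o) o.
  rewrite (metric_sym (b i n o) (a i o)).
  rewrite -/(len (a i)) -/(len (b i n)).
  by split; lra.
have e2 : \forall n \near \oo, forall i j,
    gp (isom_inv (b i n) o) (b j n o) < C.
  apply: filter_forall => i; apply: filter_forall => j.
  pose e := (C - gp (isom_inv (a i) o) (a j o)) / 2.
  have e0 : 0 < e by rewrite divr_gt0// subr_gt0.
  apply: filterS2 (nearbV i _ e0) (nearb j _ e0) => n ni nj.
  have := gp_perturb o (isom_inv (b i n) o) (b j n o) (isom_inv (a i) o).
  have := gp_perturb o (b j n o) (isom_inv (a i) o) (a j o).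
  rewrite (gpC _ (b j n o)) (gpC _ (a j o)) !(metric_sym _ (a j o)).
  rewrite (metric_sym _ (isom_inv (a i) o)).
  by rewrite /e in ni nj; lra.
have e3 : \forall n \near \oo, forall i j, i <> j ->
    2 * C + 6 * delta + 5 < mdist (b i n o) (b j n o).
  apply: filter_forall => i; apply: filter_forall => j.
  have [->|ij] := pselect (i = j); first by apply: nearW => n.
  pose e := (mdist (a i o) (a j o) - (2 * C + 6 * delta + 5)) / 2.
  have e0 : 0 < e by rewrite divr_gt0// subr_gt0; exact: sep_a.
  apply: filterS2 (nearb i _ e0) (nearb j _ e0) => n ni nj _.
  have := metric_triangle (a i o) (b i n o) (a j o).
  have := metric_triangle (b i n o) (b j n o) (a j o).
  by rewrite /e in ni nj; rewrite metric_sym in nj; lra.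
by apply: filterS3 e1 e2 e3.
Qed.

End schottky_ex.

(** * Lower semicontinuity *)

Lemma lee_from_below (R : realType) (x y : \bar R) :
  (forall c : R, (c%:E < x)%E -> (c%:E <= y)%E) -> (x <= y)%E.
Proof.
case: x => [x| |] xy; last exact: leNye.
  apply/lee_subgt0Pr => e e0; rewrite -EFinB; apply: xy.
  by rewrite lte_fin ltrBlDr ltrDl.
by rewrite (@eq_infty _ y)// => c; apply: xy; exact: ltry.
Qed.

Theorem mainTheorem5 (R : realType) (X : metricType R) (o : X)
    (Gamma_ : nat -> set (metric_isometry X)) (Gamma : set (metric_isometry X)) :
  proper_space X ->
  gromov_hyperbolic o ->
  compact_boundary o ->
  (forall n, isom_semigroup (Gamma_ n)) ->
  isom_semigroup Gamma ->
  geometric_cvg Gamma_ Gamma ->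
  (exists xi eta, [/\ limit_set Gamma o xi, limit_set Gamma o eta & xi <> eta]) ->
  (isom_entropy o Gamma <= limn_einf (fun n => isom_entropy o (Gamma_ n)))%E.
Proof.
move=> Xproper [delta d0 hypX] cB Gs_ Gs [cvgG _] [xi [eta [xiG etaG xieta]]].
have [u [v [[uc uG] [vc vG] uv]]] := limit_set_two_sequences hypX xiG etaG xieta.
have [C C0 dir] := orbit_points_towards d0 hypX uc vc uv.
have [A A0 coloring] := direction_coloring d0 hypX C0 dir cB.
have turning := reducible_turning_limit_set d0 hypX cB Gs C0 dir uc uG vc vG uv.
have [g0 Gg0 _] := uG 0%N.
have entropy_ge_ (c : R) : (c%:E < isom_entropy o Gamma)%E ->
    \forall n \near \oo, (c%:E <= isom_entropy o (Gamma_ n))%E.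
  move=> cG; have [c0|c0] := ltP c 0.
    have [g_ [Gg_ _]] := cvgG _ Gg0.
    apply: nearW => n; apply: (@le_trans _ _ 0%E); first by rewrite lee_fin ltW.
    by apply: entropy_ge0; exists (g_ n o), (g_ n).
  move: cG; rewrite /isom_entropy /entropy; case: ifPn => _.
    by rewrite lte_fin ltNge c0.
  move=> /ereal_sup_gt[_ [S Ssep <-]] cS.
  have [h ch hS] : exists2 h, c < h &
      (h%:E < growth_exponent o (orbit_of Gamma o `&` S))%E.
    move: (growth_exponent _ _) cS => [x| |]//.
      by rewrite lte_fin => cx; exists ((c + x) / 2); rewrite ?lte_fin; lra.
    by exists (c + 1); [lra|exact: ltry].
  have [C' [r [N [a [[C'0 rC'] N0 Sa Ga lnN]]]]] :=
    schottky_ex d0 hypX Xproper turning A0 coloring Ssep c0 ch hS.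
  have /choice[b bP] i := cvgG _ (Ga i).
  have := schottky_near Sa (fun i => (bP i).2).
  apply: filterS => n Sb.
  apply: le_trans (schottky_entropy d0 hypX C'0 rC' N0 Sb (Gs_ n) _); last first.
    by move=> i; exact: (bP i).1.
  by rewrite lee_fin ler_pdivlMr// ltr0n.
apply: lee_from_below => c /entropy_ge_ near_c.
rewrite /limn_einf /limn_esup -/(limf_einf _ _).
by apply: le_limf_einf near_c _.
Qed.
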